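(* Let $\mu$ be a probability measure on $\mathbb{R}$. If there exists a probability measure $\nu$ on $\mathbb{R}$ with support included in $(-\infty,0]$ such that $\mu*\nu\in\mathscr{C}$, then $\mu\in\mathscr{C}$.
   Context: $\mathscr{C}$ is the set of probability measures $\mu$ on $\mathbb{R}$ such that every probability measure $\mu_1$ on $\mathbb{R}$ with $\mu_1^{*n}=\mu^{*n}$ on the Borel subsets of $[0,\infty)$ for all $n\ge1$ ($*n$ = $n$-fold convolution power) satisfies $\mu_1=\mu$. *)

(* Defs.v *)
From HB Require Import structures.
From mathcomp Require Import all_boot all_order all_algebra.
From mathcomp Require Import all_classical all_reals all_analysis.
Set Implicit Arguments. Unset Strict Implicit. Unset Printing Implicit Defensive.
Import Order.TTheory GRing.Theory Num.Theory.
Import numFieldNormedType.Exports.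
Local Open Scope classical_set_scope.
Local Open Scope ring_scope.

Definition mconv (R : realType) (m1 m2 : set R -> \bar R) : set R -> \bar R :=
  pushforward (m1 \x m2)%E (fun p : R * R => p.1 + p.2).

Fixpoint convn (R : realType) (m : set R -> \bar R) (n : nat) : set R -> \bar R :=
  match n with
  | 0%N => (\d_(0 : R) : set R -> \bar R)
  | 1%N => m
  | n'.+1 => mconv (convn m n') m
  end.

Definition classC (R : realType) (mu : set R -> \bar R) : Prop :=
  forall mu1 : probability R R,
    (forall n : nat, (0 < n)%N ->
       forall A : set R, measurable A -> A `<=` `[0, +oo[ ->
         convn mu1 n A = convn mu n A) ->
    forall A : set R, measurable A -> mu1 A = mu A.

Definition msupport (R : realType) (m : set R -> \bar R) : set R :=
  [set x | forall r : R, 0 < r -> (0 < m (ball x r))%E].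

(* Main.v *)
Require Import Defs.
From HB Require Import structures.
From mathcomp Require Import all_boot all_order all_algebra.
From mathcomp Require Import all_classical all_reals all_analysis.
From mathcomp Require Import measurable_realfun ring lra.
Import Order.TTheory GRing.Theory Num.Theory.
Import numFieldNormedType.Exports.
Local Open Scope classical_set_scope.
Local Open Scope ring_scope.

(**
If mu1 satisfies mu1^{*n} = mu^{*n} on [0, oo) for all n >= 1, then so do the
powers of mu1 * nu and mu * nu, because nu^{*n} lives on (-oo, 0] and translating
a subset of [0, oo) to the right keeps it in [0, oo). Hence mu1 * nu = mu * nu.
To cancel nu, note that mu1 and mu agree on [0, oo), so that only their
restrictions to (-oo, 0) have to be compared; these and nu have finite integrals
of expR (k x), which are multiplicative under convolution and positive for nu.
The restrictions thus have the same moments in the variable expR x in (0, 1],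
and they coincide since suitable polynomials in expR x converge boundedly to the
indicators of half-lines.
*)

(** * Convolution of finite measures as a measure on the line *)

Section convolution_measure.
Context {R : realType}.
Local Open Scope ereal_scope.

Let measurable_add : measurable_fun [set: R * R] (fun p : R * R => p.1 + p.2)%R.
Proof. exact: measurable_funD. Qed.

Lemma measurable_fun_shift (y : R) : measurable_fun setT (fun x : R => x + y)%R.
Proof. exact: measurable_funD. Qed.

Section finite.
Variables m1 m2 : {finite_measure set R -> \bar R}.

Let mconv0 : mconv m1 m2 set0 = 0.
Proof. by rewrite /mconv /pushforward preimage_set0 measure0. Qed.

Let mconv_ge0 A : 0 <= mconv m1 m2 A.
Proof. exact: measure_ge0. Qed.

Let mconv_sigma_additive : semi_sigma_additive (mconv m1 m2).
Proof.
exact: (@measure_semi_sigma_additive _ _ _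
  (measure_function_pushforward__canonical__measure_function_Measure
    (m1 \x m2) measurable_add)).
Qed.

HB.instance Definition _ := isMeasure.Build _ _ _ (mconv m1 m2)
  mconv0 mconv_ge0 mconv_sigma_additive.

Let mconv_fin : fin_num_fun (mconv m1 m2).
Proof.
apply: lty_fin_num_fun; rewrite /= /mconv /pushforward preimage_setT -setXTT.
by rewrite product_measure1E// ltey_eq fin_numM// fin_num_measure.
Qed.

HB.instance Definition _ := Measure_isFinite.Build _ _ _ (mconv m1 m2) mconv_fin.

Lemma ge0_integral_mconv (f : R -> \bar R) :
  measurable_fun [set: R] f -> (forall x, 0 <= f x) ->
  \int[mconv m1 m2]_z f z = \int[m1]_x \int[m2]_y f (x + y)%R.
Proof.
move=> mf f0; rewrite ge0_integral_pushforward//.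
rewrite preimage_setT fubini_tonelli1//=.
exact: measurableT_comp.
Qed.

Lemma ge0_integral_mconv_swap (f : R -> \bar R) :
  measurable_fun [set: R] f -> (forall x, 0 <= f x) ->
  \int[mconv m1 m2]_z f z = \int[m2]_y \int[m1]_x f (x + y)%R.
Proof.
move=> mf f0; rewrite ge0_integral_pushforward//.
rewrite preimage_setT fubini_tonelli2//=.
exact: measurableT_comp.
Qed.

(** Tonelli with the second variable outermost: what is known about where [m2] lives then restricts
    the translations of [A] that occur. *)
Lemma mconvE (A : set R) : measurable A ->
  mconv m1 m2 A = \int[m2]_y m1 ((fun x : R => x + y)%R @^-1` A).
Proof.
move=> mA; rewrite -[in LHS](setIT A) -integral_indic//.
rewrite ge0_integral_mconv_swap//; last exact/measurable_EFinP/measurable_indic.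
apply: eq_integral => y _; rewrite -[in RHS](setIT (_ @^-1` _)) -integral_indic//.
by rewrite -[X in measurable X]setTI; exact: measurable_fun_shift.
Qed.

Lemma measurable_fun_measure_shift (A : set R) : measurable A ->
  measurable_fun setT (fun y : R => m1 ((fun x : R => x + y)%R @^-1` A)).
Proof.
move=> mA.
pose B : set (R * R) := (fun p => p.1 + p.2)%R @^-1` A.
rewrite [X in measurable_fun _ X](_ : _ = m1 \o ysection B).
  apply: measurable_fun_ysection.
  by rewrite -[X in measurable X]setTI; exact: measurable_add.
apply/funext => y /=; congr (m1 _).
by apply/seteqP; split => x; rewrite /ysection/= inE.
Qed.

End finite.

Section probability.
Variables m1 m2 : probability R R.

Let mconv_setT : mconv m1 m2 setT = 1.
Proof.
rewrite /mconv /pushforward preimage_setT -setXTT product_measure1E//.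
by rewrite /= !probability_setT mule1.
Qed.

HB.instance Definition _ :=
  Measure_isProbability.Build _ _ _ (mconv m1 m2) mconv_setT.

End probability.

(** Same recursion as [convn], but with values in bundled probability measures, so that lemmas on
    measures apply to the powers. *)
Fixpoint convn_prob (m : probability R R) n : probability R R :=
  match n with
  | 0%N => \d_(0%R : R)
  | 1%N => m
  | n'.+1 => mconv (convn_prob m n') m
  end.

Lemma convn_probE (m : probability R R) n :
  convn_prob m n = convn m n :> (set R -> \bar R).
Proof.
by elim: n => [//|[//|n] IH]; rewrite -[RHS]/(mconv (convn m n.+1) m) -IH.
Qed.

End convolution_measure.

(** * Algebra of convolution: commutativity, associativity, powers of a product *)

Section convolution_algebra.
Context {R : realType}.
Local Open Scope ereal_scope.
Implicit Types (m : {finite_measure set R -> \bar R}) (A : set R).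

Lemma mconv_indicE m1 m2 A : measurable A ->
  mconv m1 m2 A = \int[m1]_x \int[m2]_y (\1_A (x + y)%R)%:E.
Proof.
move=> mA; rewrite -[in LHS](setIT A) -integral_indic//.
rewrite (ge0_integral_mconv m1 m2)//; exact/measurable_EFinP/measurable_indic.
Qed.

Lemma mconv_indicE_swap m1 m2 A : measurable A ->
  mconv m1 m2 A = \int[m2]_y \int[m1]_x (\1_A (x + y)%R)%:E.
Proof.
move=> mA; rewrite -[in LHS](setIT A) -integral_indic//.
rewrite (ge0_integral_mconv_swap m1 m2)//; exact/measurable_EFinP/measurable_indic.
Qed.

Lemma mconvC m1 m2 A : measurable A -> mconv m1 m2 A = mconv m2 m1 A.
Proof.
move=> mA; rewrite (mconv_indicE_swap m1 m2 _ mA) (mconv_indicE m2 m1 _ mA).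
by apply: eq_integral => x _; apply: eq_integral => y _; rewrite addrC.
Qed.

(** Both sides unfold to the same triple integral of the indicator of [A] at x + y + z. *)
Lemma mconvA m1 m2 m3 A : measurable A ->
  mconv (mconv m1 m2) m3 A = mconv m1 (mconv m2 m3) A.
Proof.
move=> mA; have mindic : measurable_fun [set: R] (fun x => (\1_A x)%:E : \bar R).
  exact/measurable_EFinP/measurable_indic.
have mF : measurable_fun [set: R] (fun x => \int[m3]_y (\1_A (x + y)%R)%:E).
  apply: (@measurable_fun_fubini_tonelli_F _ _ _ _ _ m3
    (fun p : R * R => (\1_A (p.1 + p.2)%R)%:E)) => //.
  by apply: (measurableT_comp mindic); exact: measurable_funD.
rewrite (mconv_indicE (mconv m1 m2) m3 _ mA) (mconv_indicE m1 (mconv m2 m3) _ mA).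
rewrite (ge0_integral_mconv m1 m2 _ mF); last by move=> x; exact: integral_ge0.
apply: eq_integral => x _.
have mx : measurable_fun [set: R] (fun z => (\1_A (x + z)%R)%:E : \bar R).
  by apply: (measurableT_comp mindic); exact: measurable_funD.
rewrite (ge0_integral_mconv m2 m3 _ mx); last by [].
by apply: eq_integral => y _; apply: eq_integral => z _; rewrite addrA.
Qed.

Lemma eq_mconv m1 m1' m2 m2' A :
  (forall B, measurable B -> m1 B = m1' B) ->
  (forall B, measurable B -> m2 B = m2' B) ->
  measurable A -> mconv m1 m2 A = mconv m1' m2' A.
Proof.
move=> m11 m22 mA; rewrite !mconv_indicE//.
rewrite (eq_measure_integral m1'); last by move=> B mB _; exact: m11.
apply: eq_integral => x _; apply: eq_measure_integral => B mB _; exact: m22.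
Qed.

Lemma mconvACA m1 m2 m3 m4 A : measurable A ->
  mconv (mconv m1 m2) (mconv m3 m4) A = mconv (mconv m1 m3) (mconv m2 m4) A.
Proof.
move=> mA; rewrite (mconvA m1 m2 (mconv m3 m4) _ mA).
rewrite (mconvA m1 m3 (mconv m2 m4) _ mA).
apply: eq_mconv => // B mB.
rewrite /= -(mconvA m2 m3 m4 _ mB) -(mconvA m3 m2 m4 _ mB).
by apply: eq_mconv => // C mC; exact: mconvC.
Qed.

(** Each further factor [mconv mu nu] is distributed over the two powers by the interchange law
    [mconvACA]. *)
Lemma convn_mconv (mu nu : probability R R) n A : measurable A ->
  convn_prob (mconv mu nu) n.+1 A =
  mconv (convn_prob mu n.+1) (convn_prob nu n.+1) A.
Proof.
elim: n A => [//|n IH] A mA.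
rewrite -[LHS]/(mconv (convn_prob (mconv mu nu) n.+1) (mconv mu nu) A).
rewrite (eq_mconv _ (mconv (convn_prob mu n.+1) (convn_prob nu n.+1))
  _ (mconv mu nu) _ IH _ mA); last by [].
exact: mconvACA.
Qed.

End convolution_algebra.

(** * Measures carried by the nonpositive reals *)

Section nonpositive.
Context {R : realType}.
Local Open Scope ereal_scope.
Implicit Types (m nu : {finite_measure set R -> \bar R}) (A : set R).

Lemma integral_nonpositive m (f : R -> \bar R) : m `]0%R, +oo[%classic = 0 ->
  measurable_fun [set: R] f -> (forall x, 0 <= f x) ->
  \int[m]_x f x = \int[m]_(x in `]-oo, 0%R]) f x.
Proof.
move=> m0 mf f0; rewrite (ge0_negligible_integral _ _ _ _ m0)//.
by rewrite setTD setCitvr.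
Qed.

(* For [y <= 0] the translate [A - y] of a set [A] of nonnegative reals is again
   made of nonnegative reals. *)
Lemma mconv_eq_nonneg m m' nu : nu `]0%R, +oo[%classic = 0 ->
  (forall A, measurable A -> A `<=` `[0%R, +oo[ -> m A = m' A) ->
  forall A, measurable A -> A `<=` `[0%R, +oo[ -> mconv m nu A = mconv m' nu A.
Proof.
move=> nu0 mm' A mA A0; rewrite (mconvE m nu)// (mconvE m' nu)//.
rewrite [LHS](integral_nonpositive nu)//; last exact: measurable_fun_measure_shift.
rewrite [RHS](integral_nonpositive nu)//; last exact: measurable_fun_measure_shift.
apply: eq_integral => y; rewrite inE/= in_itv/= => y0; apply: mm'.
  by rewrite -[X in measurable X]setTI; exact: measurable_fun_shift.
move=> x /= /A0; rewrite /= !in_itv/= !andbT => h.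
by rewrite (le_trans h)// gerDl.
Qed.

(** For y <= 0 the condition x + y > 0 forces x > 0, so every translate that counts is [m]-null. *)
Lemma mconv_nonpositive m nu : m `]0%R, +oo[%classic = 0 ->
  nu `]0%R, +oo[%classic = 0 ->
  mconv m nu `]0%R, +oo[%classic = 0.
Proof.
move=> m0 nu0; rewrite mconvE// (integral_nonpositive nu)//; last first.
  exact: measurable_fun_measure_shift.
apply: integral0_eq => y /=; rewrite in_itv/= => y0.
apply/eqP; rewrite eq_le measure_ge0 andbT -m0 le_measure ?inE//.
  by rewrite -[X in measurable X]setTI; exact: measurable_fun_shift.
move=> x /=; rewrite !in_itv/= !andbT => h.
by rewrite (lt_le_trans h)// gerDl.
Qed.

Lemma convn_prob_nonpositive (nu : probability R R) n : nu `]0%R, +oo[%classic = 0 ->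
  convn_prob nu n.+1 `]0%R, +oo[%classic = 0.
Proof. by move=> nu0; elim: n => // n IH; exact: mconv_nonpositive. Qed.

(** A Lindelöf argument: each x > 0 has a null ball around it, hence lies in a null ball with
    rational centre and radius, and there are countably many of these. *)
Lemma msupport_nonpositive m : msupport m `<=` `]-oo, 0%R] ->
  m `]0%R, +oo[%classic = 0.
Proof.
move=> supp.
pose B (p : rat * rat) : set R := ball (ratr p.1 : R) (ratr p.2 : R).
(* The null rational balls, enumerated by codes of pairs; every other code gives the empty set. *)
pose F (n : nat) : set R :=
  if unpickle n is Some p then if m (B p) == 0 then B p else set0 else set0.
apply: measure_negligible => //.
apply: (@negligibleS _ _ _ _ (\bigcup_n F n)); last first.
  apply: negligible_bigcup => n; rewrite /F.
  case: unpickle => [p|]; last exact: negligible_set0.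
  case: ifPn => [/eqP h|_]; last exact: negligible_set0.
  by apply/negligibleP => //; exact: measurable_ball.
move=> x /=; rewrite in_itv/= andbT => x0.
have : ~ msupport m x.
  by move=> /supp/=; rewrite in_itv/= leNgt x0.
move=> /existsNP[r /not_implyP[r0 /negP]]; rewrite -leNgt => mr.
(* With s < r / 2 and the centre q within s of x, the ball of radius s at q contains x and stays
   inside [ball x r]. *)
have [s] : exists s : rat, (ratr s : R) \in `]0%R, (r / 2)%R[.
  by apply: rat_in_itvoo; rewrite divr_gt0.
rewrite in_itv/= => /andP[s0 sr].
have [q] : exists q : rat, (ratr q : R) \in `]x, (x + ratr s)%R[.
  by apply: rat_in_itvoo; rewrite ltrDl.
rewrite in_itv/= => /andP[xq qs].
exists (pickle (q, s)); first exact: I.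
rewrite /F pickleK.
rewrite ifT; first by rewrite /B /ball/= gtr0_norm ?subr_gt0// ltrBlDl.
rewrite eq_le measure_ge0 andbT (le_trans _ mr)// le_measure ?inE//.
- exact: measurable_ball.
- exact: measurable_ball.
- move=> z; rewrite /B /ball/= !ltr_distl => /andP[z1 z2].
  by apply/andP; split; lra.
Qed.
End nonpositive.

(** * Finite measures on the nonpositive reals are determined by their moments in [expR x] *)

Section laplace_uniqueness.
Context {R : realType}.
Implicit Types b x : R.

(** Bernoulli's inequality; the induction step only drops the nonnegative term N t^2. *)
Lemma bernoulli_le (t : R) N : 0 <= t <= 1 -> 1 - N%:R * t <= (1 - t) ^+ N.
Proof.
move=> /andP[t0 t1]; elim: N => [|N IH]; first by rewrite mul0r subr0 expr0.
rewrite exprS (le_trans _ (ler_wpM2l _ IH)) ?subr_ge0// -natr1.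
have : 0 <= N%:R * t ^+ 2 by rewrite mulr_ge0 ?sqr_ge0.
rewrite expr2; nra.
Qed.

(* Evaluated at [expR x] with [x <= 0], these polynomials tend to the indicator
   of [x < - b]: with [u = expR x], the product of the exponent with [u ^+ n.+1]
   is about [n.+1 * expR (n.+1 * (x + b))]. *)
Definition step_poly (b : R) (n : nat) : {poly R} :=
  (1 - 'X^(n.+1)) ^+ Num.truncn (n.+1%:R * expR (n.+1%:R * b)).

Lemma horner_step_poly b n x :
  (step_poly b n).[expR x] =
  (1 - expR (n.+1%:R * x)) ^+ Num.truncn (n.+1%:R * expR (n.+1%:R * b)).
Proof.
by rewrite /step_poly horner_exp hornerD hornerN hornerXn hornerC
  (expRM_natl n.+1 x).
Qed.

Lemma step_poly_itv b n x : x <= 0 -> 0 <= (step_poly b n).[expR x] <= 1.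
Proof.
move=> x0; rewrite horner_step_poly.
have t1 : expR (n.+1%:R * x) <= 1 by rewrite -expR0 ler_expR mulr_ge0_le0.
have t0 := expR_ge0 (n.+1%:R * x).
by rewrite exprn_ge0 ?subr_ge0//= exprn_ile1 ?subr_ge0// gerBl.
Qed.

(** By Bernoulli the defect from 1 is at most n.+1 * exp (- u) with u = - n.+1 * (b + x) > 0. *)
Lemma step_poly_ge b n x : x < - b -> x <= 0 ->
  1 - 2 / (b + x) ^+ 2 * harmonic n <= (step_poly b n).[expR x].
Proof.
move=> xb x0; rewrite horner_step_poly.
have t1 : expR (n.+1%:R * x) <= 1 by rewrite -expR0 ler_expR mulr_ge0_le0.
have t0 := expR_ge0 (n.+1%:R * x).
apply: le_trans (bernoulli_le _ _ _); last by rewrite t0.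
rewrite lerD2l lerN2.
have d0 : 0 < - (b + x) by lra.
set N := Num.truncn _.
have NE : N%:R <= n.+1%:R * expR (n.+1%:R * b).
  by rewrite truncn_le mulr_ge0// expR_ge0.
apply: (le_trans (ler_wpM2r t0 NE)).
rewrite -[leLHS]mulrA -expRD -mulrDr -[X in expR X]opprK expRN -mulrN.
(* A quadratic lower bound on the exponential is enough: it beats the factor n.+1 and leaves a
   multiple of 1 / n.+1. *)
have e1 : (n.+1%:R * - (b + x)) ^+ 2 / 2 <= expR (n.+1%:R * - (b + x)).
  have := @expR_ge1Dxn R (n.+1%:R * - (b + x)) 1.
  rewrite mulr_ge0 ?(ltW d0)// => /(_ isT); apply: le_trans.
  by rewrite lerDr.
have nd0 : 0 < (n.+1%:R * - (b + x)) ^+ 2 / 2.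
  by rewrite divr_gt0// exprn_gt0// mulr_gt0.
rewrite (@le_trans _ _ (n.+1%:R * ((n.+1%:R * - (b + x)) ^+ 2 / 2)^-1))//.
  by rewrite ler_wpM2l// lef_pV2 ?posrE ?expR_gt0.
rewrite le_eqVlt; apply/orP; left; apply/eqP; rewrite /harmonic/=.
have bx0 : b + x != 0 by rewrite lt_eqF//; lra.
by field; rewrite bx0 /= nat1r pnatr_eq0.
Qed.

(** From 1 - t <= exp (- t) the value is at most exp (- N t), and exp (N t) >= 1 + N t >= n.+1. *)
Lemma step_poly_le b n x : - b <= x -> x <= 0 ->
  (step_poly b n).[expR x] <= harmonic n.
Proof.
move=> xb x0; rewrite horner_step_poly.
have t1 : expR (n.+1%:R * x) <= 1 by rewrite -expR0 ler_expR mulr_ge0_le0.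
have t0 := expR_ge0 (n.+1%:R * x).
set N := Num.truncn _.
(* Truncation loses at most 1, which costs at most t <= 1 in N t; the summand 1 in 1 + N t makes up
   for it. *)
have NE : n.+1%:R * expR (n.+1%:R * b) - 1 <= N%:R.
  by rewrite lerBlDr natr1 ltW// truncnS_gt.
set t := expR (n.+1%:R * x) in t1 t0 *.
rewrite (@le_trans _ _ (expR (- t) ^+ N))//.
  apply: lerXn2r; rewrite ?nnegrE ?subr_ge0 ?expR_ge0//.
  exact: expR_ge1Dx.
rewrite -expRM_natl mulrN expRN /harmonic/= lef_pV2 ?posrE ?expR_gt0//.
apply: le_trans (expR_ge1Dx _).
have e1 : 1 <= expR (n.+1%:R * b) * t.
  by rewrite -expRD -mulrDr -[leLHS]expR0 ler_expR mulr_ge0//; lra.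
have := ler_wpM2r t0 NE.
have : n.+1%:R * 1 <= n.+1%:R * (expR (n.+1%:R * b) * t) by rewrite ler_wpM2l.
lra.
Qed.

Lemma cvg_step_poly b x : x <= 0 ->
  (step_poly b n).[expR x] @[n --> \oo] --> (\1_(`]-oo, (- b)[%classic) x : R).
Proof.
move=> x0; rewrite indicE; have [xb|bx] := ltP x (- b).
  rewrite mem_set//=.
  apply: (@squeeze_cvgr _ _ _ _
    (fun n => 1 - 2 / (b + x) ^+ 2 * harmonic n) (fun=> 1)).
  - apply: nearW => n; rewrite step_poly_ge//=.
    by have /andP[] := step_poly_itv b n x x0.
  - rewrite -[X in _ --> X]subr0; apply: cvgB; first exact: cvg_cst.
    rewrite -(mulr0 (2 / (b + x) ^+ 2)); apply: cvgM; first exact: cvg_cst.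
    exact: cvg_harmonic.
  - exact: cvg_cst.
rewrite memNset/=; last by rewrite in_itv/= ltNge bx.
apply: (@squeeze_cvgr _ _ _ _ (fun=> 0) harmonic).
- apply: nearW => n; rewrite step_poly_le// andbT.
  by have /andP[] := step_poly_itv b n x x0.
- exact: cvg_cst.
- exact: cvg_harmonic.
Qed.

Local Open Scope ereal_scope.
Implicit Types m : {finite_measure set R -> \bar R}.

Lemma measurable_horner_expR (p : {poly R}) (D : set R) :
  measurable_fun D (fun x => p.[expR x])%R.
Proof.
apply: measurable_funTS; apply: continuous_measurable_fun => x.
apply: (@continuous_comp _ _ _ expR (fun y => p.[y])%R).
  exact: continuous_expR.
exact: continuous_horner.
Qed.

Lemma integrable_expRX m k :
  m.-integrable `]-oo, 0%R] (fun x => (expR x ^+ k)%:E).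
Proof.
apply: (@le_integrable _ _ _ _ _ _ _ (cst 1)) => //.
- apply/measurable_EFinP.
  rewrite (_ : (fun _ => _) = (fun x => ('X^k).[expR x])%R).
    exact: measurable_horner_expR.
  by apply/funext => x; rewrite hornerXn.
- move=> x /=; rewrite in_itv/= => x0; rewrite lee_fin normr1 ger0_norm.
    by rewrite exprn_ile1 ?expR_ge0// -expR0 ler_expR.
  by rewrite exprn_ge0 ?expR_ge0.
- exact: finite_measure_integrable_cst.
Qed.

Lemma integral_horner_expR m (p : {poly R}) :
  \int[m]_(x in `]-oo, 0%R]) (p.[expR x])%:E =
  \sum_(i < size p) (p`_i)%:E * \int[m]_(x in `]-oo, 0%R]) (expR x ^+ i)%:E.
Proof.
under eq_integral => x _.
  rewrite horner_coef -sumEFin.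
  under eq_bigr do rewrite EFinM.
  over.
rewrite integral_sum//=; last first.
  by move=> i; apply: integrableZl => //; exact: integrable_expRX.
apply: eq_bigr => i _; rewrite integralZl//; exact: integrable_expRX.
Qed.

(** Dominated convergence with the constant bound 1; b >= 0 places the limiting half-line inside the
    domain of integration. *)
Lemma cvg_integral_step_poly m b : (0 <= b)%R ->
  \int[m]_(x in `]-oo, 0%R]) ((step_poly b n).[expR x])%:E @[n --> \oo] -->
  m `]-oo, (- b)%R[%classic.
Proof.
move=> b0.
have := @dominated_convergence _ _ R m `]-oo, 0%R]%classic
  (measurable_itv `]-oo, 0%R])
  (fun n x => ((step_poly b n).[expR x])%:E)
  (fun x => (\1_(`]-oo, (- b)%R[%classic) x)%:E) (cst 1).
case.
- by move=> n; apply/measurable_EFinP; exact: measurable_horner_expR.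
- exact/measurable_EFinP/measurable_indic.
- apply: aeW => x /=; rewrite in_itv/= => x0.
  by apply: cvg_EFin; [exact: nearW|exact: cvg_step_poly].
- exact: finite_measure_integrable_cst.
- apply: aeW => x n /=; rewrite in_itv/= => x0; rewrite lee_fin.
  by have /andP[? ?] := step_poly_itv b n x x0; rewrite ger0_norm.
move=> _ _; rewrite integral_indic// setIidl//.
move=> x /=; rewrite !in_itv/= => xb; rewrite (le_trans (ltW xb))//.
by rewrite oppr_le0.
Qed.

Lemma laplace_unique m m' : m `]0%R, +oo[%classic = 0 ->
  m' `]0%R, +oo[%classic = 0 ->
  (forall k, \int[m]_x (expR x ^+ k)%:E = \int[m']_x (expR x ^+ k)%:E) ->
  forall A, measurable A -> m A = m' A.
Proof.
move=> m0 m'0 mm' A mA.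
have mexp k : measurable_fun [set: R] (fun x : R => (expR x ^+ k)%:E).
  by apply/measurable_EFinP/measurable_funX; exact: measurable_expR.
have mmD k : \int[m]_(x in `]-oo, 0%R]) (expR x ^+ k)%:E =
             \int[m']_(x in `]-oo, 0%R]) (expR x ^+ k)%:E.
  by rewrite -!integral_nonpositive// => x; rewrite lee_fin exprn_ge0 ?expR_ge0.
(* The moment of order 0 is the total mass. *)
have mT : m setT = m' setT.
  by have := mm' 0%N; under eq_integral do rewrite expr0;
    under [in RHS]eq_integral do rewrite expr0; rewrite !integral_cst// !mul1e.
(* Open left half-lines form a generating class closed under intersection, so it suffices to compare
   the measures on them. *)
apply: (measure_unique (@RGenInftyO.G R) (fun n => `]-oo, n%:R[%classic)) => //.
- exact: RGenInftyO.measurableE.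
- move=> _ _ [x ->] [y ->]; exists (Num.min x y).
  by apply/seteqP; split=> z /=; rewrite !in_itv/= lt_min => /andP.
- by move=> n; exists n%:R.
- apply/seteqP; split=> // x _; exists (Num.truncn `|x|).+1 => //=.
  by rewrite in_itv/= (le_lt_trans (ler_norm x))// truncnS_gt.
- move=> _ [x ->]; have [x0|x0] := leP x 0%R.
    have xn : (0 <= - x)%R by rewrite oppr_ge0.
    (* For x <= 0 both masses are limits of integrals of the same polynomials in [expR y], which the
       moments determine. *)
    pose int (k : {finite_measure set R -> \bar R}) n :=
      \int[k]_(y in `]-oo, 0%R]) ((step_poly (- x) n).[expR y])%:E.
    have mmE : int m = int m'.
      apply/funext => n; rewrite /int !integral_horner_expR.
      by apply: eq_bigr => i _; rewrite mmD.
    have h := cvg_integral_step_poly m _ xn; rewrite -/(int m) mmE opprK in h.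
    have h' := cvg_integral_step_poly m' _ xn; rewrite opprK in h'.
    exact: (cvg_unique _ h h').
  (* For x > 0 the half-line carries the whole mass. *)
  have mc (k : {finite_measure set R -> \bar R}) : k `]0%R, +oo[%classic = 0 ->
      k `]-oo, x[%classic = k setT.
    move=> k0; rewrite -setCitvr -setTD measureD// ?setTI.
      rewrite [X in _ - X](_ : _ = 0) ?sube0//.
      apply/eqP; rewrite eq_le measure_ge0 andbT -k0 le_measure ?inE//.
      move=> y /=; rewrite !in_itv/= !andbT; exact: lt_le_trans.
    by rewrite ltey_eq fin_num_measure.
  exact: etrans (mc m m0) (etrans mT (esym (mc m' m'0))).
- by move=> n; rewrite ltey_eq fin_num_measure.
Qed.

End laplace_uniqueness.

(** * Cancelling a convolution factor carried by the nonpositive reals *)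

Section cancellation.
Context {R : realType}.
Local Open Scope ereal_scope.
Implicit Types (m nu : {finite_measure set R -> \bar R}) (A : set R).

(** Tonelli, and the exponential turns x + y into a product. *)
Lemma integral_expRX_mconv m nu k :
  \int[mconv m nu]_z (expR z ^+ k)%:E =
  \int[m]_x (expR x ^+ k)%:E * \int[nu]_y (expR y ^+ k)%:E.
Proof.
have mexp : measurable_fun [set: R] (fun x : R => (expR x ^+ k)%:E).
  by apply/measurable_EFinP/measurable_funX; exact: measurable_expR.
have exp_ge0 (x : R) : 0 <= (expR x ^+ k)%:E by rewrite lee_fin exprn_ge0 ?expR_ge0.
rewrite (ge0_integral_mconv m nu _ mexp exp_ge0).
rewrite -ge0_integralZr//; last exact: integral_ge0.
apply: eq_integral => x _; rewrite -ge0_integralZl//.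
by apply: eq_integral => y _; rewrite expRD exprMn EFinM.
Qed.

(** The integrand vanishes nowhere, so a zero integral would make the whole line null. *)
Lemma integral_expRX_gt0 nu k : nu setT != 0 ->
  0 < \int[nu]_y (expR y ^+ k)%:E.
Proof.
move=> nuT.
have mexp : measurable_fun [set: R] (fun x : R => (expR x ^+ k)%:E).
  by apply/measurable_EFinP/measurable_funX; exact: measurable_expR.
have exp_ge0 (x : R) : 0 <= (expR x ^+ k)%:E by rewrite lee_fin exprn_ge0 ?expR_ge0.
rewrite lt_neqAle integral_ge0// andbT eq_sym; apply: contra_neq nuT => int0.
have /(ae_eq_integral_abs nu measurableT mexp) h :
    \int[nu]_y `|(expR y ^+ k)%:E| = 0.
  by rewrite -int0; apply: eq_integral => y _; rewrite gee0_abs.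
apply: measure_negligible => //; apply: negligibleS h => y _ /= /(_ I) [] /eqP.
by rewrite expf_eq0 gt_eqF ?andbF ?expR_gt0.
Qed.

Lemma integral_expRX_fin_num nu k : nu `]0%R, +oo[%classic = 0 ->
  \int[nu]_y (expR y ^+ k)%:E \is a fin_num.
Proof.
move=> nu0; rewrite (integral_nonpositive nu)//.
  exact/integrable_fin_num/integrable_expRX.
by apply/measurable_EFinP/measurable_funX; exact: measurable_expR.
Qed.

Lemma mconv_cancel_nonpositive m m' nu : nu setT != 0 ->
  nu `]0%R, +oo[%classic = 0 ->
  m `]0%R, +oo[%classic = 0 -> m' `]0%R, +oo[%classic = 0 ->
  (forall A, measurable A -> mconv m nu A = mconv m' nu A) ->
  forall A, measurable A -> m A = m' A.
Proof.
move=> nuT nu0 m0 m'0 mm'; apply: laplace_unique => // k.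
have : \int[mconv m nu]_z (expR z ^+ k)%:E = \int[mconv m' nu]_z (expR z ^+ k)%:E.
  by apply: eq_measure_integral => A mA _; exact: mm'.
rewrite !integral_expRX_mconv => /eqP.
(* In the extended reals the positive finite factor is cancelled from each of the two
   inequalities. *)
rewrite eq_le !lee_pmul2r ?integral_expRX_fin_num ?integral_expRX_gt0//.
by rewrite -eq_le => /eqP.
Qed.

(* Splitting [m] along the sign leaves only the parts on the negative reals to
   be compared. *)
Lemma mconv_cancel m m' nu : nu setT != 0 -> nu `]0%R, +oo[%classic = 0 ->
  (forall A, measurable A -> A `<=` `[0%R, +oo[ -> m A = m' A) ->
  (forall A, measurable A -> mconv m nu A = mconv m' nu A) ->
  forall A, measurable A -> m A = m' A.
Proof.
move=> nuT nu0 mpos mm' A mA.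
have mN : measurable (`]-oo, 0%R[%classic : set R) by [].
have mP : measurable (`[0%R, +oo[%classic : set R) by [].
have split (k : {finite_measure set R -> \bar R}) B : measurable B ->
    k B = mrestr k mN B + mrestr k mP B.
  move=> mB; rewrite /mrestr -measureU//; last 3 first.
  - exact: measurableI.
  - exact: measurableI.
  - apply/seteqP; split=> // x /= [[_ +] [_ +]]; rewrite !in_itv/= andbT.
    by move=> x0; rewrite leNgt x0.
  by rewrite -setIUr -setCitvr setUC setUv setIT.
have mposE B : measurable B -> mrestr m mP B = mrestr m' mP B.
  move=> mB; apply: mpos; first exact: measurableI.
  exact: subIsetr.
have mnegE B : measurable B -> mrestr m mN B = mrestr m' mN B.
  have neg0 (k : {finite_measure set R -> \bar R}) :
      mrestr k mN `]0%R, +oo[%classic = 0.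
    rewrite /mrestr (_ : _ `&` _ = set0) ?measure0//.
    apply/seteqP; split=> // x /= []; rewrite !in_itv/= andbT => x0 x1.
    by have := lt_trans x0 x1; rewrite ltxx.
  apply: (mconv_cancel_nonpositive _ _ nu nuT nu0 (neg0 m) (neg0 m')) => C mC.
  have convD (k : {finite_measure set R -> \bar R}) :
      mconv k nu C = mconv (mrestr k mN) nu C + mconv (mrestr k mP) nu C.
    rewrite !mconvE// -ge0_integralD//; last 2 first.
    - exact: measurable_fun_measure_shift.
    - exact: measurable_fun_measure_shift.
    apply: eq_integral => y _; apply: split.
    by rewrite -[X in measurable X]setTI; exact: measurable_fun_shift.
  have := mm' C mC; rewrite (convD m) (convD m').
  (* The nonnegative parts contribute the same finite amount to both sides, which can therefore be
     subtracted. *)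
  rewrite [X in _ + X = _](eq_mconv _ (mrestr m' mP) _ nu _ mposE _ mC)//.
  move/(congr1 (fun z => z - mconv (mrestr m' mP) nu C)).
  by rewrite !addeK ?fin_num_measure.
by rewrite (split m)// (split m')// mposE// mnegE.
Qed.

End cancellation.

(** * Transfer of the class from [mconv mu nu] to [mu] *)

Theorem theorem5p2 (R : realType) (mu : probability R R) :
  (exists nu : probability R R,
     msupport nu `<=` `]-oo, 0] /\ classC (mconv mu nu)) ->
  classC mu.
Proof.
move=> [nu [supp CC]] mu1 mu1E.
have nu0 := msupport_nonpositive nu supp.
have nuT : nu setT != 0%E by rewrite probability_setT onee_eq0.
apply: (mconv_cancel mu1 mu nu nuT nu0) => [A mA A0|].
  exact: (mu1E 1%N).
(* The membership of [mconv mu nu] is tested against the competitor [mconv mu1 nu], whose powers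
   split into powers of [mu1] and of [nu]. *)
apply: (CC (mconv mu1 nu)) => -[//|n] _ A mA A0.
rewrite -[in LHS](convn_probE (mconv mu1 nu)) -[in RHS](convn_probE (mconv mu nu)).
rewrite (convn_mconv mu1 nu _ _ mA) (convn_mconv mu nu _ _ mA).
apply: mconv_eq_nonneg => //; first exact: convn_prob_nonpositive.
move=> B mB B0; rewrite -[LHS]/(convn_prob mu1 n.+1 B).
by rewrite -[RHS]/(convn_prob mu n.+1 B) !convn_probE; exact: mu1E.
Qed.
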